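(* Every $\mathbb{Z}$-shift of finite type which has zero-dimensional topologically completely positive entropy (ZTCPE) also has topologically completely positive entropy (TCPE).
   Context: A $\mathbb{Z}$ topological dynamical system $(X,T)$ is a compact metric space $X$ with a homeomorphism $T$ of $X$ (generating the $\mathbb{Z}$-action $\{T^n\}_{n\in\mathbb{Z}}$). For a finite set $A$ (an alphabet), $A^{\mathbb{Z}}$ carries the product of discrete topologies and the shift $\sigma$ given by $(\sigma x)(s)=x(s+1)$. A $\mathbb{Z}$-subshift is a nonempty closed subset $X$ of some $A^{\mathbb{Z}}$ with $\sigma(X)=X$, regarded as the topological dynamical system $(X,\sigma)$. A pattern over $A$ is an element of $A^S$ for some finite $S\subset\mathbb{Z}$; patterns are identified up to translation. A $\mathbb{Z}$-shift of finite type (SFT) is a (nonempty) $\mathbb{Z}$-subshift consisting of all $x\in A^{\mathbb{Z}}$ in which no pattern from some fixed finite set $\mathcal{F}$ of patterns appears. The topological entropy is $h(X,T)=\sup_{\mathcal{U}}\lim_{n\to\infty}\frac1n\log N\left(\bigvee_{i=1}^n T^i\mathcal{U}\right)$, where $\mathcal{U}$ ranges over open covers of $X$ and $N(\cdot)$ is the minimal cardinality of a subcover. A factor map $(X,T)\to(Y,S)$ is a continuous map $\phi:X\to Y$ with $\phi\circ T=S\circ\phi$. $(X,T)$ has TCPE if for every surjective factor map from $(X,T)$ to a $\mathbb{Z}$ topological dynamical system $(Y,S)$, either $h(Y,S)>0$ or $|Y|=1$. $(X,T)$ has ZTCPE if for every surjective factor map from $(X,T)$ to a $\mathbb{Z}$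 topological dynamical system $(Y,S)$ with $Y$ zero-dimensional (i.e. having a basis of clopen sets), either $h(Y,S)>0$ or $|Y|=1$. *)

(* Defs.v *)
From HB Require Import structures.
From mathcomp Require Import all_boot all_order all_algebra finmap.
From mathcomp Require Import all_classical all_reals all_analysis.

Set Implicit Arguments.
Unset Strict Implicit.
Unset Printing Implicit Defensive.

Import Order.TTheory GRing.Theory Num.Theory.
Import numFieldNormedType.Exports.

Local Open Scope classical_set_scope.
Local Open Scope ring_scope.

Section DynamicalSystems.
Context {X : topologicalType}.

Definition homeomorphism (T : X -> X) : Prop :=
  continuous T /\ exists T' : X -> X, [/\ continuous T', cancel T T' & cancel T' T].

(* The metric of a dynamical system is carried by the type of its phase space,
   see [tcpe]. *)
Definition compact_dynamics (T : X -> X) : Prop :=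
  compact [set: X] /\ homeomorphism T.

(* Basis of clopen sets; the library's [zero_dimensional] only asks clopen sets
   to separate points. *)
Definition has_clopen_basis : Prop :=
  exists2 B : set (set X), B `<=` clopen & basis B.

Definition open_cover (U : set (set X)) : Prop :=
  U `<=` open /\ \bigcup_(A in U) A = [set: X].

Definition cover_join (U V : set (set X)) : set (set X) :=
  [set A `&` B | A in U & B in V].

Definition cover_image (f : X -> X) (U : set (set X)) : set (set X) :=
  [set f @` A | A in U].

(* T^1 U v ... v T^n U; the unit of the join is the trivial cover {X} *)
Definition iterated_join (T : X -> X) (U : set (set X)) (n : nat) :
    set (set X) :=
  \big[cover_join/[set [set: X]]]_(1 <= i < n.+1) cover_image (iter i T) U.

Definition finite_subcover (U : set (set X)) (V : {fset (set X)}) : Prop :=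
  [set` V] `<=` U /\ \bigcup_(A in [set` V]) A = [set: X].

(* Infimum of a set of natural numbers, hence a minimum as soon as U has a
   finite subcover. *)
Definition cover_number (R : realType) (U : set (set X)) : R :=
  inf [set (#|` V|)%:R | V in finite_subcover U].

Definition cover_entropy (R : realType) (T : X -> X) (U : set (set X)) : R :=
  limn (fun n => ln (cover_number R (iterated_join T U n)) / n%:R).

Definition entropy (R : realType) (T : X -> X) : \bar R :=
  ereal_sup [set (cover_entropy R T U)%:E | U in open_cover].

End DynamicalSystems.

Definition factor_map (X Y : topologicalType) (T : X -> X) (S : Y -> Y)
    (phi : X -> Y) : Prop :=
  continuous phi /\ phi \o T = S \o phi.

Definition tcpe (R : realType) (X : topologicalType) (T : X -> X) : Prop :=
  forall (Y : metricType R) (S : Y -> Y) (phi : X -> Y),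
    compact_dynamics S ->
    factor_map T S phi -> range phi = [set: Y] ->
    (0 < entropy R S)%E \/ exists y : Y, [set: Y] = [set y].

Definition ztcpe (R : realType) (X : topologicalType) (T : X -> X) : Prop :=
  forall (Y : metricType R) (S : Y -> Y) (phi : X -> Y),
    compact_dynamics S -> @has_clopen_basis Y ->
    factor_map T S phi -> range phi = [set: Y] ->
    (0 < entropy R S)%E \/ exists y : Y, [set: Y] = [set y].

Definition full_shift (A : finType) : topologicalType :=
  {ptws int -> discrete_topology A}.

Definition shift_map (A : finType) (x : full_shift A) : full_shift A :=
  fun s => x (s + 1).

Record subshift (A : finType) := Subshift {
  points :> set (full_shift A);
  subshift_nonempty : points !=set0;
  subshift_closed : closed points;
  subshift_invariant : @shift_map A @` points = points }.

Lemma subshift_shift_map (A : finType) (X : subshift A) (x : full_shift A) :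
  points X x -> points X (shift_map x).
Proof. by move=> Xx; rewrite -subshift_invariant; exists x. Qed.

(* [set_type (points X)] carries the subspace topology. *)
Definition subshift_map (A : finType) (X : subshift A) (x : set_type (points X)) :
    set_type (points X) :=
  SigSub (mem_set (subshift_shift_map (set_valP x))).

Lemma compact_full_shift (A : finType) : compact [set: full_shift A].
Proof.
have cA : compact [set: discrete_topology A].
  by apply: finite_compact; exact: (@finite_finset A setT).
have := @tychonoff int (fun=> discrete_topology A) (fun=> setT) (fun=> cA).
by congr (compact _); apply/seteqP.
Qed.

Lemma continuous_coords (A : finType) (Y : topologicalType)
    (f : Y -> full_shift A) :
  (forall s : int, continuous ((fun y => f y s) : Y -> discrete_topology A)) ->
  continuous f.
Proof.
move=> cf y; apply/cvg_sup => s.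
exact: (@continuous_comp_initial _ _ _ (fun x : full_shift A => x s) f (cf s)).
Qed.

Lemma compact_set_type (T : topologicalType) (B : set T) :
  compact B -> compact [set: set_type B].
Proof.
move=> cB F PF _; have [] := cB ((@set_val T B) @ F) _.
  have : F setT by exact: filterT.
  by apply: (@filterS _ F _ _ (set_val @^-1` B)) => x _; exact: set_valP.
move=> p [Bp clp]; exists (SigSub (mem_set Bp)); split=> // U V FU nV.
case: nV => W [[] O oO <- Op] OV.
have FU' : (set_val @ F) (set_val @` U).
  by apply: (@filterS _ F _ U (set_val @^-1` (set_val @` U)) _ FU) => u Uu; exists u.
have [|x [[u Uu <-] Ou]] := clp _ O FU'; first by apply: open_nbhs_nbhs.
by exists u; split=> //; exact: OV.
Qed.

Lemma subshift_dynamics (A : finType) (X : subshift A) :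
  compact_dynamics (@subshift_map A X).
Proof.
have shift_pre (x : full_shift A) : points X x ->
    points X ((fun s => x (s - 1)) : full_shift A).
  rewrite -{1}subshift_invariant => -[y Xy <-].
  suff -> : (fun s => shift_map y (s - 1)) = y by [].
  by apply/funext => s; rewrite /shift_map subrK.
split.
  apply: compact_set_type.
  exact: (subclosed_compact (@subshift_closed _ X) (@compact_full_shift A)).
pose g (x : set_type (points X)) : set_type (points X) :=
  SigSub (mem_set (shift_pre _ (set_valP x))).
have coordc s : continuous
    ((fun x : set_type (points X) => set_val x s) : _ -> discrete_topology A).
  move=> x.
  have c1 : {for x, continuous (set_val : set_type (points X) -> full_shift A)}.
    exact: initial_continuous.
  have c2 : {for set_val x, continuous
      ((fun y : full_shift A => y s) : _ -> discrete_topology A)}.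
    exact: (@proj_continuous int (fun=> discrete_topology A)).
  exact: continuous_comp c1 c2.
split.
  by apply: continuous_comp_initial; apply: continuous_coords => s; exact: coordc.
exists g; split.
- by apply: continuous_comp_initial; apply: continuous_coords => s; exact: coordc.
- move=> x; apply: val_inj; apply/funext => s /=; rewrite /shift_map subrK //.
- move=> x; apply: val_inj; apply/funext => s /=; rewrite /shift_map addrK //.
Qed.

(* w is a pattern of A^S for S = domf w; the existential translation makes
   [appears] depend only on w up to translation. *)
Definition appears (A : finType) (w : {fmap int -> A}) (x : full_shift A) :
    Prop :=
  exists t : int, forall (s : int) (a : A), w.[? s]%fmap = Some a -> x (t + s) = a.

Definition sft (A : finType) (X : subshift A) : Prop :=
  exists F : {fset {fmap int -> A}},
    points X = [set x | forall w, w \in F -> ~ appears w x].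

(* Main.v *)
Require Import Defs.
From HB Require Import structures.
From mathcomp Require Import all_boot all_order all_algebra finmap.
From mathcomp Require Import all_classical all_reals all_analysis.
From mathcomp Require Import zify lra.

(** The proof splits on a combinatorial property of the words of the shift of
finite type X. Fix L so large that two points of X which agree on L
consecutive coordinates can be glued there ([sft_gluing]), and let the
vertices of a finite graph be the words of length L read in X, with an edge
from u to v when some point reads u and then, one step later, v. Iterating the
successor map D |-> D' on sets of vertices is a dynamical system on a finite
set, which gives a dichotomy ([primitive_or_periodic_set]):

- either there is one N such that every vertex reaches every vertex in exactly
  N steps; or

- the orbit of some vertex ends in a cycle C of sets none of which contains all
  the vertices.

In the second case X has a nontrivial zero-dimensional factor of entropy zero,
so it does not have ZTCPE. The factor records, at each time s, which members D
of C contain the word read at s. A point that is in D at time s is in D' at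
time s + 1, so along each of the finitely many moving targets D, D', D'', and
so on, membership can only switch from false to true. A word of length n of
the factor is thus determined by one switching time for each target
([itinerary_code]); there are polynomially many such words, and a symbolic
system with polynomially many words has entropy zero
([polynomial_complexity_entropy0]). The factor has two points because some
vertex is in D and another one is not. This argument treats together the three
ways in which X can fail to be mixing: transient words, several irreducible
components, and a period.

In the first case X has the specification property
([primitive_specification]): arbitrary finite orbit segments can be followed
one after the other with a constant gap. Let phi be a factor map onto Y and let
phi x0 and phi x1 be distinct. The complements of two disjoint closed balls
around these points form an open cover of Y, and a set of its n-th iterated
join cannot contain two points that pass, at the same time, through different
balls. Specification gives 2^k points that run through the two balls in all
possible orders during k blocks of constant length M, so the join of length
k M needs at least 2^k sets and the entropy is at least (ln 2) / M
([specification_tcpe]). The limit that defines the entropy of a cover has to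
be known to exist for this; it does, because the logarithms of the cover
numbers are subadditive ([fekete_cvg], [cover_entropy_cvg]). *)

Set Implicit Arguments.
Unset Strict Implicit.
Unset Printing Implicit Defensive.

Import Order.TTheory GRing.Theory Num.Theory.
Import numFieldNormedType.Exports.

Local Open Scope classical_set_scope.
Local Open Scope ring_scope.

(** * Limits of averages *)

Lemma cvg_cst_over_nat (R : realType) (C : R) :
  (fun n => C / n%:R) @ \oo --> (0 : R).
Proof.
rewrite -(mulr0 C); apply: cvgMr.
apply/gtr0_cvgV0; last exact: cvgr_idn.
by near=> n; rewrite ltr0n; near: n; exists 1%N.
Unshelve. all: by end_near. Qed.

(** Fekete's lemma: the limit is the infimum of u n / n. Dividing n by an m that
almost attains the infimum bounds u n by (n / m) u m up to a constant. *)
Lemma fekete_cvg (R : realType) (u : nat -> R) :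
  (forall n, 0 <= u n) -> (forall m n, u (m + n)%N <= u m + u n) ->
  cvgn (fun n => u n / n%:R).
Proof.
move=> u0 usub.
pose E : set R := [set u n.+1 / n.+1%:R | n in [set: nat]].
have E0 : E !=set0 by exists (u 1%N / 1), 0%N.
have lbE : has_lbound E by exists 0 => _ [n _ <-]; rewrite divr_ge0.
apply/cvg_ex; exists (inf E); apply/cvgrPdist_le => e e0.
have [|_ [m _ <-] um] := @inf_adherent _ E (e / 2) _ (conj E0 lbE).
  by rewrite divr_gt0.
(* C bounds u at every possible remainder modulo m.+1. *)
pose C := \sum_(r < m.+1) u r.
have uq q r : u (q * m.+1 + r)%N <= q%:R * u m.+1 + u r.
  elim: q => [|q IH]; first by rewrite mul0r add0r.
  rewrite mulSn -addnA (le_trans (usub _ _))// -natr1 mulrDl mul1r.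
  by rewrite addrC -[leRHS]addrA [u m.+1 + _]addrC addrA lerD2r.
have uC n : u n <= (n %/ m.+1)%:R * u m.+1 + C.
  rewrite {1}(divn_eq n m.+1) (le_trans (uq _ _))// lerD2l /C.
  have nm : (n %% m.+1 < m.+1)%N by rewrite ltn_mod.
  by rewrite (bigD1 (Ordinal nm))//= lerDl sumr_ge0.
have := cvg_cst_over_nat C => /cvgrPdist_le/(_ (e / 2)) [|k _ kC].
  by rewrite divr_gt0.
exists k.+1 => //= n kn.
have n0 : 0 < n%:R :> R by rewrite ltr0n (leq_trans _ kn).
have infn : inf E <= u n / n%:R.
  by apply: (ge_inf lbE); exists n.-1; rewrite ?prednK ?(leq_trans _ kn).
have := kC n (ltnW kn) => /=; rewrite sub0r normrN => /ler_normlW Cn.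
rewrite ler0_norm ?subr_le0// opprB lerBlDl.
apply: (@le_trans _ _ (u m.+1 / m.+1%:R + C / n%:R)); last first.
  by rewrite {1}[e]splitr addrA lerD// ltW.
rewrite ler_pdivrMr// (le_trans (uC n))// mulrDl divfK ?gt_eqF// lerD2r.
rewrite [leRHS]mulrAC -[leRHS]mulrA [leLHS]mulrC ler_wpM2l ?u0//.
rewrite ler_pdivlMr// -natrM.
by rewrite ler_nat; exact: leq_trunc_div.
Qed.

(** From ln x < x applied to e x: ln x is below e x - ln e, for every e > 0. *)
Lemma ln_affine_over_nat (R : realType) (c : nat) :
  (fun n => ln (n + c.+1)%:R / n%:R) @ \oo --> (0 : R).
Proof.
apply/cvgrPdist_le => e e0.
pose e' := e / 2; have e'0 : 0 < e' by rewrite divr_gt0.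
pose C : R := e' * c.+1%:R - ln e'.
have := cvg_cst_over_nat C => /cvgrPdist_le/(_ e' e'0) [k _ kC].
exists k.+1 => //= n kn.
have n0 : 0 < n%:R :> R by rewrite ltr0n (leq_trans _ kn).
have ln0 : 0 <= ln (n + c.+1)%:R :> R by rewrite ln_ge0// ler1n addnS.
rewrite sub0r normrN ger0_norm ?divr_ge0// ler_pdivrMr//.
have := kC n (ltnW kn) => /=; rewrite sub0r normrN => /ler_normlW.
rewrite ler_pdivrMr// => Cn.
have nc0 : 0 < (n + c.+1)%:R :> R by rewrite ltr0n addnS.
have := @ln_sublinear R (e' * (n + c.+1)%:R).
rewrite mulr_gt0// lnM ?posrE// => /(_ isT).
have -> : e = e' + e' by rewrite /e' -splitr.
move: Cn; rewrite /C natrD mulrDl mulrDr; lra.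
Qed.

(** * Cover numbers and iterated joins *)

Lemma iter_cancel (T : Type) n (f f' : T -> T) : cancel f f' ->
  cancel (iter n f) (iter n f').
Proof. by move=> fK; elim: n => // n IH x; rewrite iterSr iterS fK IH. Qed.

Section Covers.
Context {X : topologicalType}.
Implicit Types U V W : set (set X).

(** A finite subcover as a family over an arbitrary finite type, possibly with
repetitions: joins and images of such families are again such families. *)
Definition subcover U (I : finType) (g : I -> set X) : Prop :=
  (forall i, U (g i)) /\ forall x, exists i, g i x.

Definition has_subcover U : Prop :=
  exists (I : finType) (g : I -> set X), subcover U g.

Lemma subcover_fset U (I : finType) (g : I -> set X) : subcover U g ->
  exists2 V : {fset (set X)}, finite_subcover U V & (#|` V| <= #|I|)%N.
Proof.
move=> [gU gc]; exists [fset x in [seq g i | i : I]]%fset.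
  split; first by move=> A /=; rewrite !inE => /mapP[i _ ->]; exact: gU.
  apply/seteqP; split=> // x _; have [i gix] := gc x.
  exists (g i) => //=; rewrite !inE; apply/mapP; exists i => //.
  by rewrite mem_enum.
by rewrite cardE -(size_map g) card_fseq; exact: size_undup.
Qed.

Lemma cover_number_le (R : realType) U (I : finType) (g : I -> set X) :
  subcover U g -> cover_number R U <= #|I|%:R.
Proof.
move=> /subcover_fset[V UV VI]; apply: (@le_trans _ _ (#|` V|)%:R).
  by apply: ge_inf; [exists 0 => _ [? _ <-]|exists V].
by rewrite ler_nat.
Qed.

Lemma cover_number_attained (R : realType) U : has_subcover U ->
  exists (I : finType) (g : I -> set X),
    subcover U g /\ cover_number R U = #|I|%:R.
Proof.
move=> [I0 [g0 c0]].
pose P n :=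
  `[< exists (I : finType) (g : I -> set X), subcover U g /\ #|I| = n >].
have exP : exists n, P n by exists #|I0|; apply/asboolP; exists I0, g0.
case: (ex_minnP exP) => n /asboolP[I [g [cg In]]] nmin.
exists I, g; split=> //; apply/eqP; rewrite eq_le (cover_number_le R cg)/=.
apply: lb_le_inf.
  by have [V UV _] := subcover_fset cg; exists (#|` V|)%:R, V.
move=> _ [V [VU Vc] <-]; rewrite ler_nat In; apply: nmin.
apply/asboolP; exists V, val; split; last by rewrite cardfE.
split=> [A|x]; first by apply: VU; exact: valP.
have [A AV Ax] : (\bigcup_(A in [set` V]) A) x by rewrite Vc.
by exists [` AV]%fset.
Qed.

Lemma cover_number_ge1 (R : realType) U (x : X) :
  has_subcover U -> 1 <= cover_number R U.
Proof.
move=> /(cover_number_attained R)[I [g [[_ gc] ->]]].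
have [i _] := gc x; rewrite ler1n; apply/card_gt0P; by exists i.
Qed.

Lemma subcover_join U V (I J : finType) (g : I -> set X) (h : J -> set X) :
  subcover U g -> subcover V h ->
  subcover (cover_join U V) (fun p : I * J => g p.1 `&` h p.2).
Proof.
move=> [gU gc] [hV hc]; split=> [[i j]|x].
  by exists (g i) => //; exists (h j).
by have [i gi] := gc x; have [j hj] := hc x; exists (i, j).
Qed.

Lemma has_subcover_join U V :
  has_subcover U -> has_subcover V -> has_subcover (cover_join U V).
Proof.
by move=> [I [g cg]] [J [h ch]]; do 2 eexists; exact: subcover_join cg ch.
Qed.

Lemma cover_number_join (R : realType) U V : has_subcover U -> has_subcover V ->
  cover_number R (cover_join U V) <= cover_number R U * cover_number R V.
Proof.
move=> /(cover_number_attained R)[I [g [cg ->]]].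
move=> /(cover_number_attained R)[J [h [ch ->]]].
have := cover_number_le R (subcover_join cg ch); by rewrite card_prod natrM.
Qed.

Lemma subcover_image (f f' : X -> X) U (I : finType) (g : I -> set X) :
  cancel f' f -> subcover U g -> subcover (cover_image f U) (fun i => f @` g i).
Proof.
move=> f'K [gU gc]; split=> [i|x]; first by exists (g i).
by have [i gi] := gc (f' x); exists i, (f' x).
Qed.

Lemma has_subcover_image (f f' : X -> X) U :
  cancel f' f -> has_subcover U -> has_subcover (cover_image f U).
Proof.
move=> f'K [I [g cg]]; do 2 eexists; exact: subcover_image f'K cg.
Qed.

Lemma cover_number_image (R : realType) (f f' : X -> X) U :
  cancel f' f -> has_subcover U ->
  cover_number R (cover_image f U) <= cover_number R U.
Proof.
move=> f'K /(cover_number_attained R)[I [g [cg ->]]].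
exact: (cover_number_le R (subcover_image f'K cg)).
Qed.

Lemma compact_has_subcover U (x0 : X) :
  compact [set: X] -> open_cover U -> has_subcover U.
Proof.
(* [compact_cover] is about pointed spaces; x0 is the point. *)
pose pX : ptopologicalType := HB.pack X (isPointed.Build X x0).
rewrite -[compact _]/(@compact pX [set: pX]) compact_cover => cX [Uo Uc].
have [|x _|D DU Dc] := cX _ U id.
- exact: Uo.
- by have : (\bigcup_(A in U) A) x by rewrite Uc.
exists D, val; split=> [A|x]; first by apply/set_mem/DU; exact: valP.
have [A AD Ax] := Dc x I.
by exists [` AD]%fset.
Qed.

Lemma cover_joinA : associative (@cover_join X).
Proof.
move=> U V W; apply/seteqP; split=> A.
  move=> [B UB [_ [C VC [D WD <-]] <-]].
  exists (B `&` C); first by exists B => //; exists C.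
  by exists D => //; rewrite setIA.
move=> [_ [B UB [C VC <-]] [D WD <-]].
exists B => //; exists (C `&` D); first by exists C => //; exists D.
by rewrite setIA.
Qed.

Lemma cover_join1 : left_id [set [set: X]] (@cover_join X).
Proof.
move=> U; apply/seteqP; split=> A.
  by move=> [_ -> [B UB <-]]; rewrite setTI.
by move=> UA; exists setT => //; exists A => //; rewrite setTI.
Qed.

Lemma cover_join1r : right_id [set [set: X]] (@cover_join X).
Proof.
move=> U; apply/seteqP; split=> A.
  by move=> [B UB [_ -> <-]]; rewrite setIT.
by move=> UA; exists A => //; exists setT => //; rewrite setIT.
Qed.

(** With this structure the iterated join can be split like any other iterated
operator. *)
HB.instance Definition _ := Monoid.isLaw.Build (set (set X)) [set [set: X]]
  (@cover_join X) cover_joinA cover_join1 cover_join1r.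

Lemma cover_image_join (f f' : X -> X) U V : cancel f f' ->
  cover_image f (cover_join U V) =
  cover_join (cover_image f U) (cover_image f V).
Proof.
move=> fK.
have fI A B : f @` (A `&` B) = f @` A `&` f @` B.
  apply/seteqP; split=> [_ [x [Ax Bx] <-]|_ [[x Ax <-] [y By]]].
    by split; exists x.
  by move=> /(can_inj fK) yx; exists x => //; split=> //; rewrite -yx.
apply/seteqP; split=> A.
  move=> [_ [B UB [C VC <-]] <-]; rewrite fI.
  by exists (f @` B); [exists B|exists (f @` C) => //; exists C].
move=> [_ [B UB <-] [_ [C VC <-] <-]]; rewrite -fI.
by exists (B `&` C) => //; exists B => //; exists C.
Qed.

Lemma cover_image1 (f f' : X -> X) : cancel f' f ->
  cover_image f [set [set: X]] = [set [set: X]].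
Proof.
move=> f'K; rewrite /cover_image image_set1; congr [set _].
by apply/seteqP; split=> // x _; exists (f' x).
Qed.

Section IteratedJoin.
Variables T T' : X -> X.
Hypotheses (TK : cancel T T') (T'K : cancel T' T).

(** The last n factors of the join of length m + n are the images under T^m of
the n factors of the join of length n; this is what makes the cover numbers
submultiplicative. *)
Lemma iterated_joinD U m n : iterated_join T U (m + n) =
  cover_join (iterated_join T U m)
             (cover_image (iter m T) (iterated_join T U n)).
Proof.
rewrite /iterated_join (big_cat_nat _ (n := m.+1))//= ?ltnS ?leq_addr//.
congr (cover_join _ _).
rewrite (big_morph (cover_image (iter m T))
  (fun U V => cover_image_join U V (iter_cancel m TK))
  (cover_image1 (iter_cancel m T'K))).
rewrite -{1}[m.+1]addn1 addnC big_addn -addnS addKn.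
apply: eq_bigr => i _; rewrite /cover_image image_comp.
apply: eq_imagel => A _ /=; rewrite image_comp.
by apply: eq_imagel => x _ /=; rewrite addnC iterD.
Qed.

Lemma iterated_joinS U n : iterated_join T U n.+1 =
  cover_join (iterated_join T U n) (cover_image (iter n.+1 T) U).
Proof. by rewrite /iterated_join big_nat_recr. Qed.

Lemma has_subcover_iterated_join U n :
  has_subcover U -> has_subcover (iterated_join T U n).
Proof.
move=> sU; elim: n => [|n IH].
  rewrite /iterated_join big_geq//.
  by exists unit, (fun=> setT); split=> // x; exists tt.
rewrite iterated_joinS; apply: has_subcover_join => //.
exact: has_subcover_image (iter_cancel n.+1 T'K) sU.
Qed.

(** The form in which lower bounds on cover numbers use the join: points in a
common set of the join are, at each earlier time, in a common set of U. *)
Lemma iterated_join_sub U n A i : iterated_join T U n A -> (0 < i <= n)%N ->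
  exists2 B, U B & A `<=` iter i T @` B.
Proof.
elim: n A => [|n IH] A; first by case: i.
rewrite iterated_joinS => -[B Bn [_ [C UC <-] <-]] /andP[i0].
rewrite leq_eqVlt => /predU1P[->|]; first by exists C => // x [].
rewrite ltnS => lin; have [|D UD BD] := IH B Bn; first by rewrite i0.
by exists D => // x [/BD].
Qed.

(** The form in which upper bounds use the join: any choice of sets of U along
an itinerary is realised by a set of the join. *)
Lemma iterated_join_cap U n (a : nat -> set X) : (forall i, U (a i)) ->
  exists2 A, iterated_join T U n A &
    forall x, (forall i, (0 < i <= n)%N -> a i (iter i T' x)) -> A x.
Proof.
move=> aU; elim: n => [|n [A An Asub]].
  by exists setT => //; rewrite /iterated_join big_geq.
exists (A `&` iter n.+1 T @` a n.+1).
  rewrite iterated_joinS; exists A => //.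
  by exists (iter n.+1 T @` a n.+1) => //; exists (a n.+1).
move=> x xa; split.
  by apply: Asub => i /andP[i0 ni]; apply: xa; rewrite i0 leqW.
exists (iter n.+1 T' x); first by apply: xa; rewrite leqnn.
exact: (iter_cancel n.+1 T'K).
Qed.

(** The point x makes the cover numbers positive, hence their logarithms
nonnegative and additive on products. *)
Lemma cover_entropy_cvg (R : realType) U (x : X) : has_subcover U ->
  cvgn (fun n => ln (cover_number R (iterated_join T U n)) / n%:R).
Proof.
move=> sU; have sUn n := has_subcover_iterated_join n sU.
have N1 n := cover_number_ge1 R x (sUn n).
have N0 n : 0 < cover_number R (iterated_join T U n).
  by rewrite (lt_le_trans _ (N1 n)).
apply: fekete_cvg => [n|m n]; first exact: ln_ge0.
rewrite -lnM ?posrE// ler_ln ?posrE ?mulr_gt0//.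
have sUmn := has_subcover_image (iter_cancel m T'K) (sUn n).
rewrite iterated_joinD (le_trans (cover_number_join _ _ _))//.
rewrite ler_wpM2l ?(ltW (N0 m))//.
exact: (cover_number_image _ (iter_cancel m T'K)).
Qed.

End IteratedJoin.
End Covers.

(** * Metric spaces of bi-infinite sequences *)

Definition agree (B : Type) (k : nat) (y z : int -> B) : Prop :=
  forall s : int, (`|s| < k)%N -> y s = z s.

Lemma agree_sym (B : Type) k (y z : int -> B) : agree k y z -> agree k z y.
Proof. by move=> yz s sk; rewrite yz. Qed.

Lemma agree_trans (B : Type) k (x y z : int -> B) :
  agree k x y -> agree k y z -> agree k x z.
Proof. by move=> xy yz s sk; rewrite xy ?yz. Qed.

Lemma agree_le (B : Type) k l (y z : int -> B) :
  (k <= l)%N -> agree l y z -> agree k y z.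
Proof. by move=> kl yz s sk; rewrite yz// (leq_trans sk). Qed.

(** A set of bi-infinite sequences as a type of its own; R is the field in which
its metric takes values. *)
Record sequence_space (R : realType) (B : finType) (Z : set (int -> B)) :=
  SequenceSpace { seq_of :> int -> B; seq_ofP : Z seq_of }.

Section SequenceSpace.
Context {R : realType} {B : finType} {Z : set (int -> B)}.
Local Notation Y := (sequence_space R Z).

Lemma seq_of_inj : injective (@seq_of R B Z).
Proof.
move=> [y Zy] [z Zz] /= yz; move: Zy Zz; rewrite yz => Zy Zz.
by congr SequenceSpace; exact: Prop_irrelevance.
Qed.

(** The distance is 1 / (k + 1) for the largest k such that y and z agree on
]-k, k[, and 0 if there is no largest k; the infimum covers both cases. *)
Definition agree_radii (y z : Y) : set R :=
  [set k.+1%:R^-1 | k in [set k | agree k y z]].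

Definition seq_dist (y z : Y) : R := inf (agree_radii y z).

Let dist_lb (y z : Y) : has_lbound (agree_radii y z).
Proof. by exists 0 => _ [k _ <-]. Qed.

Let dist_ne (y z : Y) : agree_radii y z !=set0.
Proof. by exists 1%:R^-1, 0%N. Qed.

Lemma seq_dist_le k (y z : Y) : agree k y z -> seq_dist y z <= k.+1%:R^-1.
Proof. by move=> yz; apply: (ge_inf (dist_lb y z)); exists k. Qed.

Lemma seq_dist_lt (e : R) (y z : Y) : seq_dist y z < e ->
  exists2 k, agree k y z & k.+1%:R^-1 < e.
Proof.
rewrite -subr_gt0 => /inf_adherent/(_ (conj (dist_ne y z) (dist_lb y z))).
by move=> [_ [k yz <-]]; rewrite -/(seq_dist y z) addrC subrK; exists k.
Qed.

Let seq_dist_ge0 (y z : Y) : 0 <= seq_dist y z.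
Proof. by apply: lb_le_inf => // _ [k _ <-]. Qed.

Lemma seq_dist_agree k (y z : Y) : seq_dist y z < k.+1%:R^-1 -> agree k.+1 y z.
Proof.
move=> /seq_dist_lt[l yz]; rewrite ltf_pV2 ?posrE// ltr_nat ltnS => kl.
exact: agree_le kl yz.
Qed.

Let seq_distxx (y : Y) : seq_dist y y = 0.
Proof.
apply/eqP; rewrite eq_le seq_dist_ge0 andbT.
apply/ler_addgt0Pr => e e0; rewrite add0r.
have [k _ ke] := near_infty_natSinv_lt (PosNum e0).
by rewrite (le_trans (@seq_dist_le k y y _))// ltW// (ke k) /=.
Qed.

Let seq_dist_eq0 (y z : Y) : seq_dist y z = 0 -> y = z.
Proof.
move=> yz; apply: seq_of_inj; apply/funext => s.
by apply: (@seq_dist_agree `|s|%N y z); rewrite ?yz ?invr_gt0.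
Qed.

Let seq_dist_sym (y z : Y) : seq_dist y z = seq_dist z y.
Proof.
rewrite /seq_dist; congr (inf (_ @` _)).
by apply/seteqP; split=> k /agree_sym.
Qed.

Let seq_dist_triangle (y x z : Y) :
  seq_dist x z <= seq_dist x y + seq_dist y z.
Proof.
apply/ler_addgt0Pr => e e0.
have [|k xy ke] := @seq_dist_lt (seq_dist x y + e / 2) x y.
  by rewrite ltrDl divr_gt0.
have [|l yz le] := @seq_dist_lt (seq_dist y z + e / 2) y z.
  by rewrite ltrDl divr_gt0.
have -> : seq_dist x y + seq_dist y z + e =
  (seq_dist x y + e / 2) + (seq_dist y z + e / 2).
  by rewrite addrACA -splitr.
have [kl|/ltnW lk] := leqP k l.
  apply: (@le_trans _ _ (k.+1%:R^-1 + 0)); last first.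
    by rewrite lerD ?(ltW ke)// (le_trans _ (ltW le)).
  rewrite addr0 seq_dist_le//; exact: agree_trans xy (agree_le kl yz).
apply: (@le_trans _ _ (0 + l.+1%:R^-1)); last first.
  by rewrite lerD ?(ltW le)// (le_trans _ (ltW ke)).
rewrite add0r seq_dist_le//; exact: agree_trans (agree_le lk xy) yz.
Qed.

HB.instance Definition _ := gen_eqMixin Y.
HB.instance Definition _ := gen_choiceMixin Y.
HB.instance Definition _ := @isMetric.Build R Y seq_dist
  seq_distxx seq_dist_eq0 seq_dist_sym seq_dist_triangle.

Lemma nbhs_agreeP (y : Y) (U : set Y) :
  nbhs y U <-> exists k, [set z : Y | agree k y z] `<=` U.
Proof.
rewrite -metricType_numDomainType.nbhs_nbhs_mdist; split.
  move=> [e /= e0 eU].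
  have [k _ ke] := near_infty_natSinv_lt (PosNum e0).
  exists k => z yz; apply: eU => /=.
  by rewrite (le_lt_trans (seq_dist_le yz))// (ke k) /=.
move=> [k kU]; exists k.+1%:R^-1 => //= z yz.
by apply: kU; apply: agree_le (seq_dist_agree yz).
Qed.

Lemma open_agree k (y : Y) : open [set z : Y | agree k y z].
Proof.
rewrite openE => z yz; apply/nbhs_agreeP; exists k => t zt.
exact: agree_trans yz zt.
Qed.

Lemma sequence_space_clopen_basis : @has_clopen_basis Y.
Proof.
exists [set [set z : Y | agree p.1 p.2 z] | p in [set: nat * Y]].
  move=> _ [[k y] _ <-] /=; split; first exact: open_agree.
  rewrite -openC openE => z /= nyz; apply/nbhs_agreeP; exists k => t zt yt.
  exact/nyz/(agree_trans yt)/agree_sym.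
split; first by move=> _ [[k y] _ <-]; exact: open_agree.
move=> y U /nbhs_agreeP[k kU].
by exists [set z : Y | agree k y z] => //; split=> //; exists (k, y).
Qed.

Lemma agree_continuous (T : topologicalType) (f : T -> Y) :
  (forall x k, \forall x' \near x, agree k (f x) (f x')) -> continuous f.
Proof.
move=> fc x U /nbhs_agreeP[k kU]; rewrite nbhs_simpl /=.
by near=> x'; apply: kU; near: x'; exact: fc.
Unshelve. all: by end_near. Qed.

(** Lebesgue's number lemma: one radius k works for all the points. *)
Lemma lebesgue_agree (U : set (set Y)) : compact [set: Y] -> open_cover U ->
  exists k, forall y : Y, exists2 A, U A & [set z : Y | agree k y z] `<=` A.
Proof.
move=> /compact_near_coveringP cY [Uo Uc].
pose P k (y : Y) := exists2 A, U A & [set z : Y | agree k y z] `<=` A.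
have [|k _ kP] := cY nat \oo P _.
  move=> y _; have [A UA Ay] : (\bigcup_(A in U) A) y by rewrite Uc.
  have /nbhs_agreeP[k kA] : nbhs y A.
    by apply: open_nbhs_nbhs; split=> //; exact: Uo.
  exists ([set z : Y | agree k y z], [set n | (k <= n)%N]).
    by split; [apply/nbhs_agreeP; exists k|exists k].
  move=> [z n] [/= yz kn]; exists A => // t zt; apply: kA.
  exact: agree_trans yz (agree_le kn zt).
by exists k => y; exact: (kP k (leqnn k) y I).
Qed.

(** By [lebesgue_agree], a set of the n-th join of U contains all the sequences
that agree with a given one on the window [-n-k, k[. So the cover number is at
most the number of words of length n + 2k, and d ln(n) / n tends to 0. The
words are counted by any code that determines them. *)
Lemma polynomial_complexity_entropy0 (T T' : Y -> Y) d (y0 : Y) :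
  compact_dynamics T ->
  (forall (y : Y) (s : int), T y s = y (s + 1)) ->
  (forall (y : Y) (s : int), T' y s = y (s - 1)) ->
  (forall (a : int) n, exists (I : finType) (c : Y -> I),
     (#|I| <= n.+1 ^ d)%N /\
     forall y z, c y = c z ->
       forall i, (i < n)%N -> y (a + i%:Z) = z (a + i%:Z)) ->
  (entropy R T <= 0)%E.
Proof.
move=> [cY _] Ts T's code.
have TK : cancel T T'.
  by move=> y; apply/seq_of_inj/funext => s; rewrite T's Ts subrK.
have T'K : cancel T' T.
  by move=> y; apply/seq_of_inj/funext => s; rewrite Ts T's addrK.
have iT' n (y : Y) (s : int) : iter n T' y s = y (s - n%:Z).
  elim: n s => [|n IH] s; first by rewrite subr0.
  by rewrite iterS T's IH; congr (seq_of y _); lia.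
apply: ub_ereal_sup => _ [U Uoc <-]; rewrite lee_fin.
have [k kU] := lebesgue_agree cY Uoc.
pose nb (y : Y) := projT1 (cid2 (kU y)).
have nbU y : U (nb y) by rewrite /nb; case: cid2.
have nbk (y : Y) : [set z : Y | agree k y z] `<=` nb y.
  by rewrite /nb; case: cid2.
have sU : has_subcover U by exact: (compact_has_subcover y0 cY Uoc).
have sUn n := has_subcover_iterated_join T'K n sU.
have Nle n :
    cover_number R (iterated_join T U n) <= ((n + (k + k).+1) ^ d)%:R.
  have [I [c [cI cE]]] := code (- (n + k)%:Z) (n + (k + k))%N.
  (* r picks a sequence for each code; y0 stands in for codes not in use. *)
  pose r i : Y :=
    if pselect (exists y, c y = i) is left h then projT1 (cid h) else y0.
  have rE y : c (r (c y)) = c y.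
    rewrite /r; case: pselect => [h|[]]; last by exists y.
    by case: cid.
  pose g i := s2val (cid2
    (iterated_join_cap T'K n (fun j => nbU (iter j T' (r i))))).
  have gU i : iterated_join T U n (g i) by rewrite /g; case: cid2.
  have gcap i x :
      (forall j, (0 < j <= n)%N -> nb (iter j T' (r i)) (iter j T' x)) -> g i x.
    by rewrite /g; case: cid2 => A ? + H; exact.
  apply: (@le_trans _ _ #|I|%:R); last by rewrite ler_nat addnS.
  apply: cover_number_le; split=> [i|y]; [exact: (gU i)|exists (c y)].
  apply: gcap => j /andP[j0 jn]; apply: nbk => s sk; rewrite !iT'.
  have [i [ilt ->]] : exists i,
      (i < n + (k + k))%N /\ s - j%:Z = - (n + k)%:Z + i%:Z.
    exists (absz (s - j%:Z + (n + k)%:Z)); lia.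
  exact: cE.
have N1 n : 1 <= cover_number R (iterated_join T U n).
  exact: (cover_number_ge1 R y0 (sUn n)).
rewrite /cover_entropy.
suff -> : limn (fun n =>
  ln (cover_number R (iterated_join T U n)) / n%:R) = 0 by [].
apply/cvg_lim => //; apply: (@squeeze_cvgr _ _ _ _ (fun=> 0)
  (fun n => d%:R * (ln (n + (k + k).+1)%:R / n%:R))).
- near=> n; rewrite divr_ge0 ?ln_ge0//= mulrA ler_wpM2r ?invr_ge0//.
  have nk0 : 0 < (n + (k + k).+1)%:R :> R by rewrite ltr0n addnS.
  rewrite mulr_natl -lnXn// -natrX ler_ln ?posrE ?Nle ?natrX ?exprn_gt0//.
  by rewrite (lt_le_trans _ (N1 n)).
- exact: cvg_cst.
- rewrite -(mulr0 (d%:R : R)); apply: cvgMr; exact: ln_affine_over_nat.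
Unshelve. all: by end_near. Qed.

End SequenceSpace.

(** * Successor sets in a finite graph *)

Lemma iter_eventually_periodic (T : finType) (f : T -> T) (x : T) :
  exists m q, (0 < q)%N /\ iter (q + m) f x = iter m f x.
Proof.
pose g (i : 'I_#|T|.+1) := iter i f x.
have /injectivePn [i [j ij gij]] : ~~ injectiveb g.
  by apply/injectiveP => /leq_card; rewrite card_ord ltnn.
wlog lij : i j ij gij / (i < j)%N.
  move=> H; have : val i != val j by [].
  by rewrite neq_ltn => /orP[|]; [exact: H|apply: H; rewrite // eq_sym].
by exists i, (j - i)%N; rewrite subn_gt0 lij subnK ?(ltnW lij).
Qed.

Section SuccessorSets.
Variables (V : finType) (e : rel V).

(** In a graph of words of a subshift every vertex that has a successor also has
a predecessor, and conversely; these are the vertices that are actually read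
in some point. *)
Definition essential (v : V) : bool := [exists w, e v w].

Hypothesis essentialE : forall v, essential v = [exists u, e u v].

Definition successors (D : {set V}) : {set V} :=
  [set v | [exists u in D, e u v]]%SET.

Lemma successorsP (D : {set V}) v :
  reflect (exists2 u, u \in D & e u v) (v \in successors D).
Proof. rewrite inE; exact: exists_inP. Qed.

Lemma iter_successors_essential (u v : V) n :
  essential u -> v \in iter n successors [set u]%SET -> essential v.
Proof.
move=> eu; case: n => [|n]; first by rewrite inE => /eqP ->.
by move=> /successorsP[w _ ewv]; rewrite essentialE; apply/existsP; exists w.
Qed.

Lemma iter_successors_inhabited (u : V) n :
  essential u -> exists v, v \in iter n successors [set u]%SET.
Proof.
move=> eu; elim: n => [|n [v vn]]; first by exists u; rewrite inE.
have /existsP[w vw] := iter_successors_essential eu vn.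
by exists w; apply/successorsP; exists v.
Qed.

Lemma successors_full (D : {set V}) :
  (forall v, essential v -> v \in D) ->
  forall v, essential v -> v \in successors D.
Proof.
move=> De v; rewrite essentialE => /existsP[u uv].
by apply/successorsP; exists u => //; apply: De; apply/existsP; exists v.
Qed.

(** If the iterated successor sets of each essential vertex eventually contain
all the essential vertices, they do so from then on ([successors_full]), and
the maximum of the finitely many waiting times is a common N. Otherwise a
vertex u whose successor sets never become full yields C: they are eventually
periodic, and C is the periodic part. *)
Lemma primitive_or_periodic_set :
  (exists N, forall u v, essential u -> essential v ->
     v \in iter N successors [set u]%SET) \/
  exists C : {set {set V}},
    [/\ forall D, D \in C -> successors D \in C,
        forall D, D \in C -> exists2 D', D' \in C & successors D' = D &
        exists D, [/\ D \in C, exists2 u, essential u & u \in D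
                             & exists2 v, essential v & v \notin D]].
Proof.
pose full n u := forall v, essential v -> v \in iter n successors [set u]%SET.
have [fu|/existsNP[u nfu]] :=
  pselect (forall u, essential u -> exists n, full n u).
  left; pose N u := if pselect (essential u) is left eu then
    projT1 (cid (fu u eu)) else 0%N.
  exists (\max_u N u)%N => u v eu.
  have fN : full (N u) u.
    by rewrite /N; case: pselect => // eu'; case: cid.
  have leN : (N u <= \max_u N u)%N by apply: leq_bigmax.
  rewrite -(subnK leN); move: (_ - _)%N v => k.
  by elim: k => // k IH; rewrite addSn iterS; exact: successors_full.
right; move: nfu => /not_implyP[eu /forallNP nfu].
have [m [q [q0 per]]] := iter_eventually_periodic successors [set u]%SET.
pose E := iter m successors [set u]%SET.
have perE : iter q successors E = E by rewrite -iterD.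
exists [set iter i successors E | i : 'I_q]%SET; split.
- move=> _ /imsetP[i _ ->]; rewrite -iterS; apply/imsetP.
  have := ltn_ord i; rewrite leq_eqVlt => /predU1P[iq|iq]; last first.
    by exists (Ordinal iq).
  by exists (Ordinal q0); rewrite //= -iterS iq perE.
- move=> _ /imsetP[[[|i] /= iq] _ ->].
    exists (iter q.-1 successors E); last by rewrite -iterS prednK.
    have q1 : (q.-1 < q)%N by rewrite prednK.
    by apply/imsetP; exists (Ordinal q1).
  exists (iter i successors E) => //.
  by apply/imsetP; exists (Ordinal (ltnW iq)).
- exists E; split.
  + by apply/imsetP; exists (Ordinal q0).
  + have [v vE] := iter_successors_inhabited m eu.
    by exists v => //; apply: iter_successors_essential vE.
  + have /existsNP[v /not_implyP[ev /negP nv]] := nfu m.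
    by exists v.
Qed.

End SuccessorSets.

(** * The topology of a subshift *)

Section SubshiftTopology.
Variables (A : finType) (X : subshift A).
Local Notation XT := (set_type (points X)).

Let coord (s : int) (x : XT) : discrete_topology A := set_val x s.

Let coord_continuous s : continuous (coord s).
Proof.
move=> x; apply: (@continuous_comp _ _ _ set_val (fun y : full_shift A => y s)).
  exact: initial_continuous.
exact: (@proj_continuous int (fun=> discrete_topology A)).
Qed.

Lemma near_agree (x : XT) k :
  \forall x' \near x, agree k (set_val x) (set_val x').
Proof.
have near1 s : \forall x' \near x, set_val x s = set_val x' s.
  have := @coord_continuous s x _ (discrete_set1 (coord s x)).
  by rewrite nbhs_simpl /=; apply: filterS => x' /esym.
elim: k => [|k IH]; first by near=> x' => s.
near=> x' => s; rewrite ltnS leq_eqVlt => /predU1P[sk|sk].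
  have [->|->] : s = k%:Z \/ s = - k%:Z by lia.
  - by near: x'; exact: near1.
  - by near: x'; exact: near1.
by move: s sk; near: x'.
Unshelve. all: by end_near. Qed.

(** Points x_k outside U that agree with x on ]-k, k[ would converge to x, since
convergence in the product topology is convergence of each coordinate. *)
Lemma nbhs_agree (x : XT) (U : set XT) : nbhs x U ->
  exists k, forall x', agree k (set_val x) (set_val x') -> U x'.
Proof.
move=> Ux; apply: contrapT => /forallNP nU.
have /choice[u uP] k : exists x', agree k (set_val x) (set_val x') /\ ~ U x'.
  by have /existsNP[x' /not_implyP] := nU k; exists x'.
have ux : set_val (u k) @[k --> \oo] --> (set_val x : full_shift A).
  apply/cvg_sup => s V [W] [[Q oQ <-]] /= Qx WV.
  exists `|s|.+1 => // k /= sk; apply: WV => /=.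
  by rewrite -(proj1 (uP k) s sk).
case: Ux => W [[Q oQ <-]] /= Qx QU.
have /ux[k _ kQ] : nbhs (set_val x) Q by exact: open_nbhs_nbhs.
by apply: (proj2 (uP k)); apply: QU; exact: (kQ k (leqnn k)).
Qed.

End SubshiftTopology.

(** * Gluing points of a shift of finite type *)

Section Gluing.
Variables (A : finType) (X : subshift A).
Implicit Types x y z : full_shift A.

Lemma subshift_translate x (t : int) :
  points X x -> points X (fun s => x (s + t)).
Proof.
have fwd n y : points X y -> points X (fun s => y (s + n%:Z)).
  elim: n y => [|n IH] y Xy.
    by rewrite (_ : (fun s => _) = y)//; apply/funext => s; rewrite addr0.
  have := IH _ (subshift_shift_map Xy).
  rewrite (_ : (fun s : int => _) = fun s : int => y (s + n.+1%:Z))//.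
  by apply/funext => s; rewrite /shift_map; congr y; lia.
have bwd n y : points X y -> points X (fun s => y (s - n%:Z)).
  elim: n y => [|n IH] y Xy.
    by rewrite (_ : (fun s => _) = y)//; apply/funext => s; rewrite subr0.
  move: (Xy); rewrite -{1}subshift_invariant => -[z Xz zy].
  rewrite (_ : (fun s => _) = fun s => z (s - n%:Z)); first exact: IH.
  by apply/funext => s; rewrite -zy /shift_map; congr z; lia.
case: t => n; first exact: fwd.
by rewrite NegzE; exact: bwd.
Qed.

(** The Markov property of shifts of finite type: past and future are
independent given L consecutive letters. *)
Definition gluing (L : nat) : Prop := forall x y,
  points X x -> points X y ->
  (forall i : int, 0 <= i < L%:Z -> x i = y i) ->
  points X (fun s => if s < 0 then x s else y s).

(** With M bounding the coordinates used by the forbidden patterns, an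
occurrence of a pattern spans at most 2 M + 1 coordinates. In the glued point,
where x and y overlap on that many, it lies entirely in x or entirely in y. *)
Lemma sft_gluing : sft X -> exists L, gluing L.
Proof.
move=> [F XF].
pose f (w : {fmap int -> A}) := (\max_(s : domf w) `|val s|)%N.
pose M := (\max_(w : F) f (val w))%N.
have leM w s a : w \in F -> w.[? s]%fmap = Some a -> (`|s| <= M)%N.
  move=> wF; case: fndP => // sw _; apply: (@leq_trans (f w)).
    by rewrite /f (bigD1 (FSetSub sw))//= leq_maxl.
  by rewrite /M (bigD1 (FSetSub wF))//= leq_maxl.
exists (M + M).+1 => x y; rewrite {1 2}XF => Xx Xy xy.
rewrite XF => w wF [t tw].
have [tM|tM] := lerP (t - M%:Z) 0.
  apply: (Xx w wF); exists t => s a wsa; rewrite -(tw _ _ wsa).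
  have sM := leM _ _ _ wF wsa.
  by case: ifPn => // s0; apply: xy; lia.
apply: (Xy w wF); exists t => s a wsa; rewrite -(tw _ _ wsa).
have sM := leM _ _ _ wF wsa.
by case: ifPn => // s0; exfalso; lia.
Qed.

Variable L : nat.
Hypothesis XL : gluing L.

Lemma glue_at x y (p q : int) : points X x -> points X y ->
  (forall i : int, 0 <= i < L%:Z -> x (p + i) = y (q + i)) ->
  exists z, [/\ points X z, forall s, s < p + L%:Z -> z s = x s
              & forall s, p <= s -> z s = y (s - p + q)].
Proof.
move=> Xx Xy xy.
have := XL (subshift_translate p Xx) (subshift_translate q Xy) _.
have H i : 0 <= i < L%:Z -> x (i + p) = y (i + q).
  by rewrite ![i + _]addrC; exact: xy.
move=> /(_ H) /(subshift_translate (- p)) Xz; eexists; split; first exact: Xz.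
  move=> s sp /=; case: ifPn => s0; first by rewrite subrK.
  by rewrite -H ?subrK//; lia.
by move=> s sp /=; case: ifPn => // s0; exfalso; lia.
Qed.

Definition window x (p : int) : {ffun 'I_L -> A} :=
  [ffun i : 'I_L => x (p + (i : nat)%:Z)].

Lemma windowP x y p q : window x p = window y q ->
  forall i : int, 0 <= i < L%:Z -> x (p + i) = y (q + i).
Proof.
move=> /ffunP xy [i|//] /= iL; have := xy (Ordinal (iL : (i < L)%N)).
by rewrite !ffunE.
Qed.

Lemma eq_window x y p q :
  (forall i : int, 0 <= i < L%:Z -> x (p + i) = y (q + i)) ->
  window x p = window y q.
Proof.
move=> xy; apply/ffunP => i; rewrite !ffunE; apply: xy.
by rewrite /=; have := ltn_ord i; lia.
Qed.

Lemma window_translate x t p : window (fun s => x (s + t)) p = window x (p + t).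
Proof. by apply/ffunP => i; rewrite !ffunE addrAC. Qed.

Definition transition : rel {ffun 'I_L -> A} := fun u v =>
  `[< exists x, [/\ points X x, window x 0 = u & window x 1 = v] >].

Lemma transition_window x p :
  points X x -> transition (window x p) (window x (p + 1)).
Proof.
move=> Xx; apply/asboolP; exists (fun s => x (s + p)).
by rewrite !window_translate add0r addrC; split=> //; exact: subshift_translate.
Qed.

Lemma essential_windowP u :
  reflect (exists2 x, points X x & window x 0 = u) (essential transition u).
Proof.
apply: (iffP existsP) => [[v /asboolP[x [Xx xu _]]]|[x Xx <-]].
  by exists x.
by exists (window x (0 + 1)); exact: transition_window.
Qed.

Lemma essential_window x p : points X x -> essential transition (window x p).
Proof.
move=> Xx; apply/existsP; exists (window x (p + 1)); exact: transition_window.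
Qed.

Lemma essential_transitionE v :
  essential transition v = [exists u, transition u v].
Proof.
apply/essential_windowP/existsP => [[x Xx <-]|[u /asboolP[x [Xx _ xv]]]].
  exists (window x (0 - 1)); rewrite -{2}[0](subrK 1); exact: transition_window.
exists (fun s => x (s + 1)); first exact: subshift_translate.
by rewrite window_translate add0r.
Qed.

(** Points reading successive edges of a path glue along the L letters of the
common vertex, so a path in the graph is read in a single point. *)
Lemma iter_successors_path u v n :
  essential transition u -> v \in iter n (successors transition) [set u]%SET ->
  exists x, [/\ points X x, window x 0 = u & window x n%:Z = v].
Proof.
move=> /essential_windowP[x0 Xx0 x0u]; elim: n v => [|n IH] v.
  by rewrite inE => /eqP ->; exists x0.
move=> /successorsP[w /IH[x [Xx xu xw]] /asboolP[y [Xy yw yv]]].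
have [|z [Xz zx zy]] := @glue_at x y n%:Z 0 Xx Xy.
  by apply: windowP; rewrite xw.
exists z; split=> //.
  rewrite -xu; apply: eq_window => i /andP[i0 iL]; apply: zx; lia.
rewrite -yv; apply: eq_window => i /andP[i0 iL].
rewrite zy; [congr y|]; lia.
Qed.

(** The specification property for two half-orbits; chains of orbit segments
follow by induction ([specification_blocks]). *)
Definition specification (N : nat) : Prop := forall x y (p q : int),
  points X x -> points X y ->
  exists z, [/\ points X z, forall s, s < p -> z s = x s
              & forall s, p + N%:Z <= s -> z s = y (s - (p + N%:Z) + q)].

Lemma primitive_specification N :
  (forall u v, essential transition u -> essential transition v ->
     v \in iter N (successors transition) [set u]%SET) ->
  specification N.
Proof.
move=> prim x y p q Xx Xy.
have [w [Xw w0 wN]] := iter_successors_path (essential_window p Xx)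
  (prim _ _ (essential_window p Xx) (essential_window q Xy)).
have [|z [Xz zx zw]] := @glue_at x w p 0 Xx Xw; first exact: windowP.
have [|z' [Xz' z'z z'y]] := @glue_at z y (p + N%:Z) q Xz Xy.
  apply: windowP; rewrite -wN; apply: eq_window => i /andP[i0 iL].
  rewrite zw; [congr w|]; lia.
exists z'; split=> // s sp.
by rewrite z'z ?zx//; lia.
Qed.

End Gluing.

(** * Specification implies completely positive entropy *)

Section Specification.
Variables (A : finType) (X : subshift A) (N : nat).
Hypothesis specX : specification X N.

(** Block j is centred at j M with M = N + 2 m + 1: consecutive blocks, each of
radius less than m, are at least N apart, and w is arbitrary. *)
Lemma specification_blocks (x : bool -> full_shift A) m k (w : nat -> bool) :
  (forall b, points X (x b)) ->
  exists2 z, points X z &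
    forall j, (j < k)%N ->
      agree m (x (w j)) (fun s => z (s + (j * (N + (m + m)).+1)%:Z)).
Proof.
move=> Xx; elim: k => [|k [z Xz zx]]; first by exists (x true).
set M := (N + (m + m)).+1 in zx *.
(* Cutting at k M - m - N puts the end of the gap at k M - m, and - m is the
   coordinate of x (w k) that has to be read there. *)
have [z' [Xz' z'z z'x]] :=
  specX ((k * M)%:Z - N%:Z - m%:Z) (- m%:Z) Xz (Xx (w k)).
exists z' => // j; rewrite ltnS leq_eqVlt => /predU1P[->|jk] s sm.
  by rewrite z'x; [congr (x _); lia|lia].
rewrite (zx j jk s sm) z'z//.
have : ((j * M)%:Z + M%:Z <= (k * M)%:Z).
  by rewrite -PoszD lez_nat -mulSnr leq_mul2r jk orbT.
rewrite /M in sm *; lia.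
Qed.

(** The set V b is the complement of the closed ball of radius D around
phi (p b). With D a third of the distance of the two centres, V false and
V true cover Y. *)
Lemma specification_tcpe (R : realType) : tcpe R (@subshift_map A X).
Proof.
move=> Y S phi [cY [cS [S' [cS' SK S'K]]]] [cphi phiS] phiY.
have phiSx x : phi (subshift_map x) = S (phi x).
  by have := congr1 (fun f => f x) phiS.
have [x0 Xx0] := subshift_nonempty X.
pose X0 : set_type (points X) := SigSub (mem_set Xx0).
have [Yy0|/existsNP[y1 y01]] := pselect (forall y, y = phi X0).
  by right; exists (phi X0); apply/seteqP; split=> // y _; exact: Yy0.
left.
have [X1 _ phiX1] : range phi y1 by rewrite phiY.
pose p b := if b then X1 else X0.
pose D := mdist (phi X0) (phi X1) / 3.
have D0 : 0 < D.
  by rewrite divr_gt0// mdist_gt0 phiX1; apply/eqP => e; apply: y01; rewrite e.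
pose V b := [set y : Y | D < mdist (phi (p b)) y].
pose U := range V.
have oV b : open (V b).
  rewrite openE => y /= Dy.
  apply/(metricType_numDomainType.nbhs_mdistP y).
  exists (mdist (phi (p b)) y - D); rewrite /= ?subr_gt0// => z /= yz.
  have := metric_triangle (phi (p b)) z y; rewrite (metric_sym z y) /V /=.
  by move: yz; lra.
have Uoc : open_cover U.
  split; first by move=> _ [b _ <-].
  apply/seteqP; split=> // y _.
  have [V0|nV0] := pselect (V false y).
    by exists (V false); [exists false|].
  exists (V true); first by exists true.
  move: nV0; rewrite /V /= => /negP; rewrite -leNgt => V0.
  have := metric_triangle (phi X0) y (phi X1); rewrite (metric_sym y (phi X1)).
  by move: V0 D0; rewrite /D; lra.
have near b : exists m, forall x',
    agree m (set_val (p b)) (set_val x') -> ~ V b (phi x').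
  apply: (@nbhs_agree A X (p b) (fun x' => ~ V b (phi x'))).
  have /cphi : nbhs (phi (p b)) (fun y => ~ V b y).
    apply/(metricType_numDomainType.nbhs_mdistP (phi (p b))).
    by exists D => //= z /= zD; apply/negP; rewrite -leNgt ltW.
  by [].
have [m pm] : exists m, forall b x',
    agree m (set_val (p b)) (set_val x') -> ~ V b (phi x').
  have [m0 pm0] := near false; have [m1 pm1] := near true.
  exists (maxn m0 m1) => -[] x' ax'.
    by apply: pm1; apply: agree_le ax'; rewrite leq_maxr.
  by apply: pm0; apply: agree_le ax'; rewrite leq_maxl.
pose M := (N + (m + m)).+1.
have sU := compact_has_subcover (phi X0) cY Uoc.
have iphi n x : iter n S (phi x) = phi (iter n (@subshift_map A X) x).
  by elim: n => //= n ->; rewrite phiSx.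
have ishift n (x : set_type (points X)) s :
    set_val (iter n (@subshift_map A X) x) s = set_val x (s + n%:Z).
  elim: n s => [|n IH] s; first by rewrite addr0.
  rewrite iterS /=.
  rewrite -[LHS]/(set_val (iter n (@subshift_map A X) x) (s + 1)) IH.
  by congr (set_val x _); lia.
have NM k : (2 ^ k)%:R <= cover_number R (iterated_join S U (k * M)).
  have [I [g [[gU gc] ->]]] :=
    cover_number_attained R (has_subcover_iterated_join S'K (k * M) sU).
  rewrite ler_nat.
  have blocks (w : {ffun 'I_k -> bool}) : exists z : set_type (points X),
      forall j : 'I_k, ~ V (w j) (iter (j * M) S (phi z)).
    pose w' j := if insub j is Some i then w i else false.
    have [|z Xz zw] :=
      @specification_blocks (fun b => set_val (p b)) m k w'.
      by move=> b; exact: set_valP.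
    exists (SigSub (mem_set Xz)) => j; rewrite iphi; apply: pm => s sm.
    rewrite ishift; have := zw j (ltn_ord j) s sm.
    by rewrite /w' valK.
  have [z zP] := choice blocks.
  have [c cP] := choice (fun w => gc (iter (k * M) S (phi (z w)))).
  (* If w and w' differ at j, any b is w j or w' j, so one of the two points is
     outside V b at time j M; [iterated_join_sub] forbids this for points that
     share a set of the join. The points are pushed forward by S^(k M), so
     that time j M is i = (k - j) M steps back. *)
  have cinj : injective c.
    move=> w w' cw; apply/ffunP => j; apply: contrapT => /eqP wj.
    have jkM : (j * M <= k * M)%N by rewrite leq_mul2r ltnW ?orbT.
    have jM : (0 < k * M - j * M <= k * M)%N.
      by rewrite subn_gt0 leq_subr ltn_mul2r ltn_ord.
    have [_ [b _ <-] gb] := iterated_join_sub (gU (c w)) jM.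
    have inV v : c v = c w -> V b (iter (j * M) S (phi (z v))).
      move=> cv; have := cP v; rewrite cv => /gb[y Vy].
      rewrite -{2}(subnK jkM) iterD.
      by move=> /(can_inj (iter_cancel (k * M - j * M) SK)) <-.
    case: (eqVneq (w j) b) => [wb|wb].
      by apply: (zP w j); rewrite wb; exact: inV.
    apply: (zP w' j).
    have -> : w' j = b by move: wj wb; clear; case: (w j) (w' j) b => -[] [].
    exact: inV.
  have := leq_card _ cinj.
  by rewrite card_ffun card_bool card_ord.
apply: (@lt_le_trans _ _ (cover_entropy R S U)%:E); last first.
  by apply: ereal_sup_ubound; exists U.
rewrite lte_fin; have cvgU := @cover_entropy_cvg _ _ _ SK S'K R _ (phi X0) sU.
have ln2 : 0 < ln 2 / M%:R :> R by rewrite divr_gt0// ln_gt0// ltr1n.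
apply: (@lt_le_trans _ _ (ln 2 / M%:R)) => //.
rewrite leNgt; apply/negP; rewrite -subr_gt0 => lt2.
(* The bound holds along the multiples of M, which suffices as the limit
   exists. *)
have /cvgrPdist_lt/(_ _ lt2)[k _ kP] := cvgU.
have := kP (k.+1 * M)%N; rewrite /= -/(cover_entropy R S U).
rewrite (leq_trans (leqnSn k))// ?leq_pmulr// => /(_ isT).
rewrite distrC => /ltr_normlW; rewrite ltrD2r ltNge => /negP; apply.
rewrite natrM invfM mulrA ler_wpM2r ?invr_ge0// ler_pdivlMr//.
rewrite mulr_natr -lnXn// -natrX ler_ln ?posrE ?NM ?natrX ?exprn_gt0//.
by rewrite (lt_le_trans _ (NM k.+1))// natrX exprn_gt0.
Qed.

End Specification.

(** * The zero-entropy factor of a periodic family of sets *)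

Section PeriodicSetFactor.
Variables (R : realType) (A : finType) (X : subshift A) (L : nat).
Local Notation V := {ffun 'I_L -> A}.
Local Notation post := (successors (@transition A X L)).
Variable C : {set {set V}}.
Hypothesis postC : forall D, D \in C -> post D \in C.
Hypothesis post_onto : forall D, D \in C -> exists2 D', D' \in C & post D' = D.

Definition itinerary (x : full_shift A) (s : int) : {set {set V}} :=
  [set D in C | window L x s \in D]%SET.

Definition itineraries : set (int -> {set {set V}}) := itinerary @` points X.

Local Notation Y := (sequence_space R itineraries).

Lemma itineraries_translate (y : int -> {set {set V}}) (t : int) :
  itineraries y -> itineraries (fun s => y (s + t)).
Proof.
move=> [x Xx <-]; exists (fun s => x (s + t)); first exact: subshift_translate.
by apply/funext => s; rewrite /itinerary window_translate.
Qed.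

Definition translate (t : int) (y : Y) : Y :=
  SequenceSpace R (itineraries_translate t (seq_ofP y)).

Lemma translate_continuous t : continuous (translate t).
Proof.
apply: agree_continuous => y k; apply/nbhs_agreeP.
exists (k + `|t|)%N => z yz s sk.
by apply: yz; lia.
Qed.

Definition itinerary_factor (x : set_type (points X)) : Y :=
  SequenceSpace R (imageP itinerary (set_valP x)).

Lemma itinerary_factor_continuous : continuous itinerary_factor.
Proof.
apply: agree_continuous => x k; near=> x' => s sk.
rewrite -[LHS]/(itinerary (set_val x) s) -[RHS]/(itinerary (set_val x') s).
rewrite /itinerary.
suff -> : window L (set_val x) s = window L (set_val x') s by [].
apply: eq_window => i /andP[i0 iL].
suff xx' : agree (k + L) (set_val x) (set_val x') by apply: xx'; lia.
by near: x'; exact: near_agree.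
Unshelve. all: by end_near. Qed.

Lemma itinerary_factor_onto : range itinerary_factor = [set: Y].
Proof.
apply/seteqP; split=> // -[y [x Xx xy]] _; exists (SigSub (mem_set Xx)) => //.
exact/seq_of_inj.
Qed.

Lemma translate_dynamics : compact_dynamics (translate 1).
Proof.
split.
  rewrite -itinerary_factor_onto; apply: continuous_compact.
    exact/continuous_subspaceT/itinerary_factor_continuous.
  by have [] := subshift_dynamics X.
split; first exact: translate_continuous.
exists (translate (- 1)); split; first exact: translate_continuous.
- by move=> y; apply/seq_of_inj/funext => s /=; rewrite subrK.
- by move=> y; apply/seq_of_inj/funext => s /=; rewrite addrK.
Qed.

(** Membership in a set that moves with [post] is never lost: this monotonicity
is why the factor is simple. *)
Lemma itinerary_step (y : Y) (s : int) D : D \in y s -> post D \in y (s + 1).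
Proof.
have [x Xx <-] := seq_ofP y; rewrite !inE => /andP[DC xD]; rewrite postC//=.
by apply/existsP; exists (window L x s); rewrite xD transition_window.
Qed.

Lemma iter_itinerary_step (y : Y) (s : int) D i j : (i <= j)%N ->
  iter i post D \in y (s + i%:Z) -> iter j post D \in y (s + j%:Z).
Proof.
move=> /subnK <-; elim: (j - i)%N => // n IH /IH /itinerary_step.
by rewrite addSn iterS -addrA -PoszD addn1.
Qed.

Lemma post_iter_onto n D : D \in C -> exists2 D', D' \in C & iter n post D' = D.
Proof.
elim: n D => [|n IH] D DC; first by exists D.
have [D1 /IH[D' D'C <-] <-] := post_onto DC; by exists D'.
Qed.

(** The code of y on the window [a, a + n[ assigns to each D the first i for
which the i-th iterate of D belongs to y (a + i), or n. It determines which
iterates of D belong to y at each time of the window, and as C is mapped onto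
itself every member of C is an i-th iterate. *)
Lemma itinerary_code (a : int) n : exists (I : finType) (c : Y -> I),
  (#|I| <= n.+1 ^ #|{set V}|)%N /\
  forall y z, c y = c z ->
    forall i, (i < n)%N -> y (a + i%:Z) = z (a + i%:Z).
Proof.
pose enters (y : Y) D i := iter i post D \in y (a + i%:Z).
pose first (y : Y) D := find (enters y D) (iota 0 n).
have first_lt y D : (first y D < n.+1)%N.
  by rewrite ltnS (leq_trans (find_size _ _))// size_iota.
have firstE y D i : (i < n)%N -> enters y D i = (first y D <= i)%N.
  move=> ilt; apply/idP/idP => [ent|fi].
    rewrite leqNgt; apply/negP => /(before_find 0).
    by rewrite nth_iota// add0n ent.
  have fn : (first y D < n)%N by exact: leq_ltn_trans fi ilt.
  apply: (iter_itinerary_step fi).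
  have := @nth_find _ 0%N (enters y D) (iota 0 n).
  by rewrite has_find size_iota nth_iota//; apply.
exists {ffun {set V} -> 'I_n.+1}, (fun y => [ffun D => Ordinal (first_lt y D)]).
split=> [|y z /ffunP yz i ilt]; first by rewrite card_ffun card_ord.
have yC (y' : Y) D : D \in y' (a + i%:Z) -> D \in C.
  by have [x Xx <-] := seq_ofP y'; rewrite inE => /andP[].
have sub D : D \in C -> (D \in y (a + i%:Z)) = (D \in z (a + i%:Z)).
  move=> /(post_iter_onto i)[D' _ <-].
  rewrite -/(enters y D' i) -/(enters z D' i) !firstE//.
  by have := congr1 val (yz D'); rewrite !ffunE /= => ->.
apply/setP => D; apply/idP/idP => Dy.
  by rewrite -sub// (yC y).
by rewrite sub// (yC z).
Qed.

Lemma itinerary_entropy0 : (entropy R (translate 1) <= 0)%E.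
Proof.
have [x0 Xx0] := subshift_nonempty X.
apply: (@polynomial_complexity_entropy0 _ _ _ _ (translate (- 1)) #|{set V}|
  (itinerary_factor (SigSub (mem_set Xx0)))) => //.
- exact: translate_dynamics.
- exact: itinerary_code.
Qed.

(** The factor has entropy zero, so under ZTCPE it is a single point, and all
the points of X have the same itinerary. *)
Lemma ztcpe_itinerary_trivial D x x' : ztcpe R (@subshift_map A X) ->
  points X x -> points X x' -> D \in C ->
  window L x 0 \in D -> window L x' 0 \in D.
Proof.
move=> ztcpeX Xx Xx' DC xD.
have [|ent|[y Yy]] := ztcpeX _ _ itinerary_factor translate_dynamics
    (@sequence_space_clopen_basis R _ itineraries) _ itinerary_factor_onto.
- split; first exact: itinerary_factor_continuous.
  apply/funext => z; apply/seq_of_inj/funext => s /=.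
  by rewrite /itinerary -window_translate.
- by have := itinerary_entropy0; rewrite leNgt ent.
have E (z : Y) : z = y by have : [set y] z by rewrite -Yy.
have := E (itinerary_factor (SigSub (mem_set Xx'))).
rewrite -(E (itinerary_factor (SigSub (mem_set Xx)))).
move=> /(congr1 (fun z : Y => D \in z 0)) /=.
by rewrite !inE DC xD.
Qed.

End PeriodicSetFactor.

(** * From ZTCPE to TCPE *)

Theorem theorem1p2 (R : realType) (A : finType) (X : subshift A) :
  sft X ->
  ztcpe R (@subshift_map A X) ->
  tcpe R (@subshift_map A X).
Proof.
move=> /sft_gluing[L XL] ztcpeX.
have [[N prim]|[C [postC post_onto [D [DC [u eu uD] [v ev /negP vD]]]]]] :=
  primitive_or_periodic_set (@essential_transitionE A X L).
  exact: (specification_tcpe (primitive_specification XL prim)).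
move: eu ev => /essential_windowP[x Xx xu] /essential_windowP[x' Xx' x'v].
case: vD; rewrite -x'v.
apply: (ztcpe_itinerary_trivial postC post_onto ztcpeX Xx Xx' DC).
by rewrite xu.
Qed.
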